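(* Let $X$ and $P$ be complete metric spaces, let $A \subset X$ be closed, let $f$ be l.s.c. on $A$, and let $\varphi$ be l.s.c. on $A \times P$. Suppose that there exist $\delta > 0$ and $\lambda_0 \ge 0$ such that, with $$C(\delta, \lambda_0) = \{ (x, p) \in \Omega_{\delta} \mid F_{\lambda_0}(x, p) < f^* \},$$ the following hold: (1) $f$ is Lipschitz continuous on the projection of $C(\delta, \lambda_0)$ onto $X$, and $f$ is upper semicontinuous at every point of this projection; (2) there exists $a > 0$ such that $\varphi^{\downarrow}_{A \times P}(x, p) \le - a$ for every $(x, p) \in C(\delta, \lambda_0) \cap \operatorname{dom} \varphi$. Then the parametric penalty function $F_{\lambda}$ is (globally) exact if and only if $F_{\lambda}$ is bounded below on $A \times P$ for some $\lambda \ge 0$.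
   Context: Setting. $X$ is a metric space, $M, A \subset X$ are nonempty, $f \colon X \to \mathbb{R} \cup \{+\infty\}$ with $\operatorname{dom} f = \{x : |f(x)| < +\infty\} \ne \emptyset$. The problem $(\mathcal{P})$ is: minimize $f(x)$ subject to $x \in M$, $x \in A$. Put $\Omega = M \cap A$; it is assumed that $f$ attains a global minimum on $\Omega$, with finite value $f^* = \min_{x\in\Omega} f(x)$. $P$ is a metric space, $p_0 \in P$ is fixed, and $\varphi \colon X \times P \to [0, +\infty]$ satisfies $\varphi(x, p) = 0$ iff $p = p_0$ and $x \in M$; $\operatorname{dom}\varphi = \{\varphi < +\infty\}$. The parametric penalty function is $F_{\lambda}(x, p) = f(x) + \lambda \varphi(x, p)$, $\lambda \ge 0$. The product $X \times P$ carries the sum metric $d((x_1,p_1),(x_2,p_2)) = d_X(x_1,x_2)+d_P(p_1,p_2)$. For $\delta > 0$, $\Omega_{\delta} = \{ (x, p) \in A \times P \mid \varphi(x, p) < \delta \}$. Global exactness: $F_\lambda$ is (globally) exact if there exists $\lambda_0 \ge 0$ such that $F_{\lambda_0}$ attains a global minimum on $A \times P$, and $(x^*, p^* )$ is a global minimizer of $F_{\lambda_0}$ on $A\times P$ iff $p^* = p_0$ and $x^*$ is a globally optimal solution of $(\mathcal{P})$. Rate of steepest descent: for a function $h$ on a metric space $Z$ with values in $[-\infty, +\infty]$, a set $S \subset Z$ and $z \in S$ with $h(z)$ finite, $h^{\downarrow}_S(z) = \liminf_{y \to z,\, y \in S,\, y\neq z} \frac{h(y) - h(z)}{d(y, z)}$,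 and $h^{\downarrow}_S(z) = +\infty$ if $z$ is an isolated point of $S$. ''L.s.c. on a set'' means lower semicontinuous at every point of that set. *)

(* Defs.v *)
From HB Require Import structures.
From mathcomp Require Import all_boot all_order all_algebra.
From mathcomp Require Import all_classical all_reals all_analysis.

Set Implicit Arguments.
Unset Strict Implicit.
Unset Printing Implicit Defensive.

Import Order.TTheory GRing.Theory Num.Theory.
Import numFieldNormedType.Exports.

Local Open Scope classical_set_scope.
Local Open Scope ring_scope.

(* The point carried by a completeType is arbitrary: it only records that the
   space is nonempty. *)
#[short(type="completeMetricType")]
HB.structure Definition CompleteMetric (R : numDomainType) :=
  {T of Complete T & Metric R T}.

(* The library topologizes X * P by the max of the two balls. The alias sum_prod
   carries the sum metric instead: the rate of steepest descent depends on the
   metric, not only on the topology. *)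
Definition sum_prod (X P : Type) : Type := (X * P)%type.

Section sum_metric.
Context {R : realType} {X P : metricType R}.
Implicit Types u v w : sum_prod X P.

Definition sum_dist u v : R := mdist u.1 v.1 + mdist u.2 v.2.

Let sum_distxx u : sum_dist u u = 0.
Proof. by rewrite /sum_dist !mdistxx addr0. Qed.

Let sum_dist_eq0 u v : sum_dist u v = 0 -> u = v.
Proof.
case: u v => [x p] [y q] /eqP.
rewrite /sum_dist /= paddr_eq0 ?mdist_ge0// => /andP[/eqP xy /eqP pq].
by move: xy pq => /mdist_positivity -> /mdist_positivity ->.
Qed.

Let sum_distC u v : sum_dist u v = sum_dist v u.
Proof. by rewrite /sum_dist metric_sym (metric_sym u.2). Qed.

Let sum_dist_triangle v u w : sum_dist u w <= sum_dist u v + sum_dist v w.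
Proof. by rewrite /sum_dist addrACA lerD// metric_triangle. Qed.

HB.instance Definition _ := Choice.copy (sum_prod X P) (X * P)%type.
HB.instance Definition _ := isMetric.Build R (sum_prod X P)
  sum_distxx sum_dist_eq0 sum_distC sum_dist_triangle.

End sum_metric.

Section extended_real_functions.
Context {R : realType}.
Local Open Scope ereal_scope.

Definition lsc_at (T : topologicalType) (h : T -> \bar R) (x : T) :=
  forall a : R, a%:E < h x -> \forall y \near x, a%:E < h y.

Definition usc_at (T : topologicalType) (h : T -> \bar R) (x : T) :=
  forall a : R, h x < a%:E -> \forall y \near x, h y < a%:E.

(* Since +oo - +oo = -oo in \bar R, taking y = x forces h to be finite on D. *)
Definition elipschitz_on (T : metricType R) (D : set T) (h : T -> \bar R) :=
  exists2 L : R, (0 <= L)%R &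
    forall x y, D x -> D y -> `|h x - h y| <= (L * mdist x y)%:E.

(* Meaningful when S z holds and h z is finite. *)
Definition steepest_descent (T : metricType R) (S : set T) (h : T -> \bar R)
    (z : T) : \bar R :=
  if `[< isolated S z >] then +oo
  else limf_einf (fun y => (h y - h z) * ((mdist y z)^-1)%:E)
         (within S z^').

Definition global_minimizer (T : Type) (S : set T) (h : T -> \bar R) (z : T) :=
  S z /\ forall y, S y -> h z <= h y.

Definition bounded_below_on (T : Type) (S : set T) (h : T -> \bar R) :=
  exists c : R, forall z, S z -> c%:E <= h z.

End extended_real_functions.

Section penalty.
Context {R : realType} {X P : metricType R}.
Local Open Scope ereal_scope.
Variables (M A : set X) (f : X -> \bar R) (p0 : P).
Variable phi : sum_prod X P -> \bar R.

Definition optimal_solution (x : X) := global_minimizer (M `&` A) f x.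

(* For lambda = 0 the convention 0 * +oo = 0 applies, so the function is f. *)
Definition penalty (lambda : R) (z : sum_prod X P) : \bar R :=
  f z.1 + lambda%:E * phi z.

Definition ambient_set : set (sum_prod X P) := A `*` [set: P].

Definition Omega (delta : R) : set (sum_prod X P) :=
  [set z | ambient_set z /\ phi z < delta%:E].

Definition C_set (delta lambda0 fstar : R) : set (sum_prod X P) :=
  [set z | Omega delta z /\ penalty lambda0 z < fstar%:E].

Definition globally_exact :=
  exists2 lambda0 : R, (0 <= lambda0)%R &
    (exists z, global_minimizer ambient_set (penalty lambda0) z) /\
    forall x p, global_minimizer ambient_set (penalty lambda0) (x, p) <->
      p = p0 /\ optimal_solution x.

End penalty.

(* Main.v *)
Require Import Defs.
From HB Require Import structures.
From mathcomp Require Import all_boot all_order all_algebra.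
From mathcomp Require Import all_classical all_reals all_analysis.
From mathcomp Require Import ring lra.
Set Implicit Arguments.
Unset Strict Implicit.
Unset Printing Implicit Defensive.
Import Order.TTheory GRing.Theory Num.Theory.
Import numFieldNormedType.Exports.
Local Open Scope classical_set_scope.
Local Open Scope ereal_scope.

(* Exactness gives a minimizer with value fstar, so F_l is bounded below.
   Conversely, it suffices to have F_l >= fstar on A x P for one large l.
   Where phi >= delta, the lower bound on F_l1 plus (l - l1) * delta exceeds
   fstar. If F_l dips below fstar at a point with phi < delta, Ekeland's
   variational principle gives z with F_l(z) < fstar and
   F_l(z) < F_l(y) + d(y, z) for all y != z. Such a z lies in C(delta, lambda0),
   so some y near z makes phi drop at rate a/2; since phi decreases and f is
   u.s.c., y stays in C(delta, lambda0), where f grows at most at the rate L of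
   its Lipschitz constant. For l * a / 2 >= L + 1 this contradicts the choice
   of z. *)

(** * Sums, positive multiples and compositions of l.s.c. functions *)

Section lower_semicontinuity.
Context {R : realType}.

Lemma lsc_atD (T : topologicalType) (h1 h2 : T -> \bar R) (x : T) :
  -oo < h1 x -> -oo < h2 x -> lsc_at h1 x -> lsc_at h2 x ->
  lsc_at (fun y => h1 y + h2 y) x.
Proof.
move=> h1x h2x lsc1 lsc2 a ax.
(* Two finite values each give up half of the slack; an infinite value absorbs whatever the other
   leaves. *)
have [b b1 b2] : exists2 b : R, b%:E < h1 x & (a - b)%:E < h2 x.
  move: h1x h2x ax; case: (h1 x) => [r| |]//; case: (h2 x) => [s| |]// _ _.
  - rewrite -EFinD lte_fin => ars; exists (r - (r + s - a) / 2)%R;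
      rewrite lte_fin; lra.
  - by move=> _; exists (r - 1)%R; rewrite ?lte_fin ?ltry//; lra.
  - by move=> _; exists (a - s + 1)%R; rewrite ?lte_fin ?ltry//; lra.
  - by move=> _; exists 0%R; rewrite ltry.
near=> y.
have -> : a = (b + (a - b))%R by ring.
rewrite EFinD; apply: lteD; near: y; [exact: lsc1|exact: lsc2].
Unshelve. all: by end_near. Qed.

Lemma lsc_atZ (T : topologicalType) (h : T -> \bar R) (x : T) (k : R) :
  (0 < k)%R -> lsc_at h x -> lsc_at (fun y => k%:E * h y) x.
Proof.
move=> k0 lsch a.
rewrite -lte_pdivrMl// -EFinM => /lsch; apply: filterS => y.
by rewrite EFinM lte_pdivrMl.
Qed.

Lemma lsc_at_comp (T U : topologicalType) (g : T -> U) (h : U -> \bar R)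
    (x : T) :
  {for x, continuous g} -> lsc_at h (g x) -> lsc_at (h \o g) x.
Proof. by move=> gx lsch a /lsch; exact: gx. Qed.

End lower_semicontinuity.

(** * Topology and completeness of the sum metric *)

Section sum_metric_topology.
Context {R : realType}.

Lemma sum_prod_fst_continuous (X P : metricType R) :
  continuous (fst : sum_prod X P -> X).
Proof.
move=> z U /nbhs_ballP[e /= e0 eU]; apply/nbhs_ballP; exists e => // y.
rewrite ballEmdist/= => zy; apply: eU; rewrite ballEmdist/=.
by apply: le_lt_trans zy; rewrite lerDl mdist_ge0.
Qed.

Lemma sum_prod_complete (X P : completeMetricType R)
    (u : nat -> sum_prod X P) :
  cauchy (u @ \oo) -> exists l : sum_prod X P, u @ \oo --> l.
Proof.
move=> /cauchyP uC.
have /cauchy_cvg ux : cauchy ((fun n => (u n).1) @ \oo).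
  apply/cauchyP => e /uC[z uz]; exists z.1.
  case: uz => N _ Nz; exists N => // n /Nz /=.
  rewrite !ballEmdist/=; apply: le_lt_trans.
  by rewrite lerDl mdist_ge0.
have /cauchy_cvg up : cauchy ((fun n => (u n).2) @ \oo).
  apply/cauchyP => e /uC[z uz]; exists z.2.
  case: uz => N _ Nz; exists N => // n /Nz /=.
  rewrite !ballEmdist/=; apply: le_lt_trans.
  by rewrite lerDr mdist_ge0.
exists (lim ((fun n => (u n).1) @ \oo), lim ((fun n => (u n).2) @ \oo)).
apply/cvg_ballP => e e0; near=> n.
rewrite ballEmdist/= (splitr e); apply: ltrD; near: n.
- have /cvg_ballP/(_ (e / 2)%R) := ux; rewrite divr_gt0// => /(_ isT).
  by apply: filterS => n; rewrite ballEmdist.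
- have /cvg_ballP/(_ (e / 2)%R) := up; rewrite divr_gt0// => /(_ isT).
  by apply: filterS => n; rewrite ballEmdist.
Unshelve. all: by end_near. Qed.

End sum_metric_topology.

(** * Ekeland's variational principle *)

Section ekeland.
Context {R : realType} (T : metricType R).
Variables (S : set T) (h : T -> \bar R) (k : R) (z0 : T).
Hypothesis T_complete :
  forall u : nat -> T, cauchy (u @ \oo) -> exists l : T, u @ \oo --> l.
Hypotheses (S_closed : closed S) (h_lsc : forall x, S x -> lsc_at h x).
Hypotheses (h_bnd : bounded_below_on S h) (k_gt0 : (0 < k)%R).
Hypotheses (Sz0 : S z0) (hz0 : h z0 < +oo).

(** Completeness enters as the property [T_complete] of sequences, so that the result applies to
    [sum_prod X P], which carries only a metric structure. *)
Lemma ekeland : exists z, [/\ S z, h z <= h z0 &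
  forall y, S y -> y != z -> h z < h y + (k * mdist y z)%:E].
Proof.
have [c hc] := h_bnd.
pose D := [set y | S y /\ h y <= h z0]; pose g y := fine (h y).
have gE y : D y -> h y = (g y)%:E.
  move=> [Sy hy]; rewrite fineK// fin_numE; apply/andP; split.
    by rewrite -ltNye (lt_le_trans _ (hc _ Sy))// ltNyr.
  by rewrite -ltey (le_lt_trans hy).
have gc y : D y -> (c <= g y)%R.
  by move=> Dy; rewrite -lee_fin -gE//; exact: hc (proj1 Dy).
(* y is in E x when moving from x to y pays for its length; u n.+1 nearly
   minimizes h on E (u n), so the nested sets E (u n) shrink to a point. *)
pose E x := [set y | D y /\ (g y + k * mdist x y <= g x)%R].
have kd_triangle (x y w : T) :
    (k * mdist x w <= k * mdist x y + k * mdist y w)%R.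
  by rewrite -mulrDr ler_wpM2l ?metric_triangle// ltW.
have Exx x : D x -> E x x by move=> Dx; split=> //; rewrite mdistxx mulr0 addr0.
have Etrans x y w : E x y -> E y w -> E x w.
  move=> [_ gyx] [Dw gwy]; split=> //.
  by have := kd_triangle x y w; lra.
(* The pair is the current point and the stage [n], which sets the tolerance [1 / (n + 1)]. *)
have /choice[s sP] (p : T * nat) : exists y, D p.1 ->
    E p.1 y /\ forall w, E p.1 w -> (g y <= g w + p.2.+1%:R^-1)%R.
  case: p => x n /=; have [Dx|] := pselect (D x); last by exists x.
  have gE_lb : has_lbound (g @` E x).
    by exists c => _ [w [Dw _] <-]; exact: gc.
  have gE_inf : has_inf (g @` E x).
    by split=> //; exists (g x), x => //; exact: Exx.
  have n0 : (0 < n.+1%:R^-1 :> R)%R by rewrite invr_gt0.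
  have [_ [y Exy <-] gy] := inf_adherent n0 gE_inf.
  exists y => _; split=> // w Exw; rewrite (le_trans (ltW gy))// lerD2r.
  by apply: ge_inf => //; exists w.
pose u := fix u n := if n is m.+1 then s (u m, m) else z0.
have Du n : D (u n).
  by elim: n => [|n IH]; [split|have [[]] := sP (u n, n) IH].
have Eu n m : (n <= m)%N -> E (u n) (u m).
  move=> /subnK <-; elim: (m - n)%N => [|j IH]; first exact: Exx.
  rewrite addSn; apply: Etrans IH _.
  by have [] := sP (u (j + n)%N, (j + n)%N) (Du _).
(* Such a [w] also lies in [E (u n)], where [u n.+1] is minimal up to [1 / (n + 1)]; so the decrease
   that pays for the move to [w] is at most that. *)
have Eu_small n w : E (u n.+1) w -> (k * mdist (u n.+1) w <= n.+1%:R^-1)%R.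
  move=> Ew; have gun : (g (u n.+1) <= g w + n.+1%:R^-1)%R.
    apply: (proj2 (sP (u n, n) (Du n))).
    exact: Etrans (Eu _ _ (leqnSn n)) Ew.
  by case: Ew => _ gw; rewrite -(lerD2l (g w)); exact: le_trans gun.
have [z uz] : exists z : T, u @ \oo --> z.
  apply: T_complete; apply/cauchyP => e e0.
  have [N _ /(_ _ (leqnn N)) /= Ne] :=
    near_infty_natSinv_lt (PosNum (mulr_gt0 k_gt0 e0)).
  exists (u N.+1); exists N.+1 => // n /= Nn; rewrite ballEmdist/=.
  rewrite -(ltr_pM2l k_gt0); apply: le_lt_trans Ne.
  exact: Eu_small (Eu _ _ Nn).
have uz_lt e : (0 < e)%R -> \forall n \near \oo, (mdist z (u n) < e)%R.
  move=> e0; have /cvg_ballP/(_ e e0) := uz.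
  by apply: filterS => n; rewrite ballEmdist.
have Sz : S z.
  by apply: closed_cvg uz => //; exists 0%N => // n _; case: (Du n).
(* Lower semicontinuity passes the inequality defining [E (u n)] to the limit. As [h z] may still be
   infinite here, a real [r] is placed strictly below it. *)
have huz n : h z <= (g (u n) - k * mdist (u n) z)%:E.
  rewrite leNgt; apply/negP => hz.
  have [r gr rz] : exists2 r,
      (g (u n) - k * mdist (u n) z < r)%R & r%:E < h z.
    move: hz; case: (h z) => [t| |]//.
    - rewrite lte_fin => gt.
      exists ((g (u n) - k * mdist (u n) z + t) / 2)%R; rewrite ?lte_fin; lra.
    - move=> _; exists (g (u n) - k * mdist (u n) z + 1)%R; rewrite ?ltry//.
      lra.
  have e0 : (0 < (r - (g (u n) - k * mdist (u n) z)) / k)%R.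
    by rewrite divr_gt0// subr_gt0.
  have : \forall m \near \oo, [/\ (n <= m)%N, r%:E < h (u m) &
      (mdist z (u m) < (r - (g (u n) - k * mdist (u n) z)) / k)%R].
    near=> m; split; near: m.
    - exact: nbhs_infty_ge.
    - by have /uz := h_lsc Sz rz.
    - exact: uz_lt.
  move=> [m _ /(_ _ (leqnn m)) /= [nm rm dm]].
  move: rm; rewrite (gE _ (Du m)) lte_fin => rm.
  have [_ gum] := Eu _ _ nm.
  have := kd_triangle (u n) (u m) z; rewrite (metric_sym (u m) z).
  by move: dm; rewrite ltr_pdivlMr//; lra.
have Dz : D z.
  split=> //; apply: le_trans (huz 0%N) _; rewrite (gE z0 (Du 0%N)) lee_fin /=.
  by rewrite gerBl mulr_ge0 ?mdist_ge0// ltW.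
have Euz n : E (u n) z.
  by split=> //; have := huz n; rewrite (gE z Dz) lee_fin; lra.
exists z; split=> [//||y Sy yz]; first by case: Dz.
rewrite ltNge; apply/negP => hyz.
have kd0 : (0 < k * mdist y z)%R by rewrite mulr_gt0// mdist_gt0.
have Dy : D y.
  split=> //; apply: le_trans (proj2 Dz); apply: le_trans hyz.
  by rewrite leeDl// lee_fin ltW.
(* A violating [y] lies in [E z], hence in every [E (u n)]: both [y] and [z] are then arbitrarily
   close to [u n.+1], although [y != z]. *)
have Ezy : E z y.
  split=> //; move: hyz; rewrite (gE y Dy) (gE z Dz) -EFinD lee_fin.
  by rewrite (metric_sym z).
have [n _ /(_ _ (leqnn n)) /=] :=
  near_infty_natSinv_lt (PosNum (divr_gt0 kd0 (ltr0n R 2))).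
have := Eu_small _ _ (Euz n.+1).
have := Eu_small _ _ (Etrans _ _ _ (Euz n.+1) Ezy).
have := kd_triangle y (u n.+1) z; rewrite (metric_sym y (u n.+1)).
move: (n.+1%:R^-1)%R => e; lra.
Unshelve. all: by end_near. Qed.

End ekeland.

(** Turns a bound on the liminf into an actual point: the infimum of the quotients over each
    punctured neighbourhood in [S] lies below [b]. At an isolated point the rate is [+oo], so the
    bound fails. *)
Lemma steepest_descent_lt (R : realType) (T : metricType R) (S : set T)
    (h : T -> \bar R) (z : T) (b : R) (V : set T) :
  h z \is a fin_num -> steepest_descent S h z < b%:E -> nbhs z V ->
  exists y, [/\ S y, V y, y != z & h y < h z + (b * mdist y z)%:E].
Proof.
move=> hz; rewrite /steepest_descent; case: ifPn => [_|_ lt_b zV].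
  by rewrite ltNge leey.
pose W := [set y | [/\ S y, V y & y != z]].
have zW : within S z^' W.
  rewrite /within/= /dnbhs /within/=; apply: filterS zV => y.
  by split.
have : ereal_inf ((fun y => (h y - h z) * ((mdist y z)^-1)%:E) @` W) < b%:E.
  apply: le_lt_trans lt_b; rewrite limf_einfE; apply: ereal_sup_ubound.
  by exists W.
move=> /ereal_inf_lt[_ [y [Sy Vy yz] <-]].
rewrite lte_pdivrMr ?mdist_gt0// => hy; exists y; split=> //.
by rewrite addeC -lteBlDr// EFinM.
Qed.

(** * Penalty values, exactness and descent *)

Section exactness.
Context {R : realType} {X P : metricType R}.
Variables (M A : set X) (f : X -> \bar R) (fstar : R) (p0 : P).
Variable phi : sum_prod X P -> \bar R.
Hypothesis f_gtNy : forall x, -oo < f x.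
Hypothesis fstar_min : exists2 x, optimal_solution M A f x & f x = fstar%:E.
Hypothesis phi_ge0 : forall z, 0 <= phi z.
Hypothesis phi_eq0 : forall x p, phi (x, p) = 0 <-> p = p0 /\ M x.

Lemma penalty_le (l1 l2 : R) (z : sum_prod X P) : (l1 <= l2)%R ->
  penalty f phi l1 z <= penalty f phi l2 z.
Proof. by move=> l12; rewrite leeD2l// lee_wpmul2r// lee_fin. Qed.

(** Reduces later steps to real arithmetic. Positivity of [l] matters: as [0 * +oo = 0], a finite
    penalty at [l = 0] would not bound [phi]. *)
Lemma penalty_lty_fin (l : R) (z : sum_prod X P) : (0 < l)%R ->
  penalty f phi l z < +oo ->
  exists r s : R, [/\ (0 <= s)%R, f z.1 = r%:E, phi z = s%:E &
    forall l', penalty f phi l' z = (r + l' * s)%:E].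
Proof.
move=> l0; rewrite /penalty; move: (f_gtNy z.1) (phi_ge0 z).
case: (f z.1) => [r| |]//; case: (phi z) => [s| |]//.
- by move=> _ s0 _; exists r, s; split.
- by rewrite gt0_muley ?lte_fin.
- by rewrite gt0_muley ?lte_fin.
Qed.

Lemma optimal_value (x : X) : optimal_solution M A f x -> f x = fstar%:E.
Proof.
have [x0 [Mx0 x0min] <-] := fstar_min => -[Mx xmin].
by apply/eqP; rewrite eq_le xmin// x0min.
Qed.

Lemma penalty_feasible (l : R) (x : X) : M x -> penalty f phi l (x, p0) = f x.
Proof.
by move=> Mx; rewrite /penalty (proj2 (phi_eq0 x p0))// mule0 adde0.
Qed.

Lemma exact_bounded_below : globally_exact M A f p0 phi ->
  exists2 l : R, (0 <= l)%R &
    bounded_below_on (ambient_set A) (penalty f phi l).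
Proof.
move=> [l l0 [_ exact]]; exists l => //.
have [x xopt fx] := fstar_min.
have [_ xmin] := proj2 (exact x p0) (conj erefl xopt).
exists fstar => z /xmin; rewrite penalty_feasible ?fx//.
by case: xopt => -[].
Qed.

(* Raising lambda makes the penalty strictly larger off the zero set of phi,
   hence removes the minimizers at which phi does not vanish. *)
Lemma exact_of_penalty_ge (l : R) : (0 <= l)%R ->
  (forall z, ambient_set A z -> fstar%:E <= penalty f phi l z) ->
  globally_exact M A f p0 phi.
Proof.
move=> l0 lmin.
have l1 : (0 < l + 1)%R by lra.
have opt_min x : optimal_solution M A f x ->
    global_minimizer (ambient_set A) (penalty f phi (l + 1)) (x, p0).
  move=> xopt; have [[Mx Ax] _] := xopt; split=> // z Az.
  rewrite penalty_feasible// (optimal_value xopt).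
  by apply: le_trans (lmin _ Az) _; apply: penalty_le; lra.
have [x0 x0opt fx0] := fstar_min.
exists (l + 1)%R; first exact: ltW.
split; first by exists (x0, p0); exact: opt_min.
move=> x p; split=> [[Axp xpmin]|[-> /opt_min//]].
have : penalty f phi (l + 1) (x, p) <= fstar%:E.
  rewrite -fx0 -(penalty_feasible (l + 1)); last by case: x0opt => -[].
  by apply: xpmin; case: x0opt => -[].
move=> le_fstar.
have [r [s [s0 fr phis penE]]] :=
  penalty_lty_fin l1 (le_lt_trans le_fstar (ltry _)).
have := lmin _ Axp; move: le_fstar; rewrite !penE !lee_fin => le1 le2.
(* [r + (l + 1) * s <= fstar <= r + l * s] leaves [s <= 0]. *)
have s_eq0 : s = 0%R by lra.
have /phi_eq0[pp0 Mx] : phi (x, p) = 0 by rewrite phis s_eq0.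
split=> //; split; first by split=> //; case: Axp.
move=> y yfeas; have [_ x0min] := x0opt.
apply: le_trans (x0min _ yfeas); rewrite fx0 fr lee_fin.
by move: le1; rewrite s_eq0 mulr0 addr0.
Qed.

Section descent.
Variables (delta lambda0 L a : R).
Let C := C_set A f phi delta lambda0 fstar.
Hypothesis f_lip : forall x y, (fst @` C) x -> (fst @` C) y ->
  `|f x - f y| <= (L * mdist x y)%:E.
Hypothesis f_usc : forall x, (fst @` C) x -> usc_at f x.
Hypotheses (L_ge0 : (0 <= L)%R) (a_gt0 : (0 < a)%R).
Hypothesis lambda0_ge0 : (0 <= lambda0)%R.
Hypothesis phi_descent : forall z, C z -> phi z < +oo ->
  steepest_descent (ambient_set A) phi z <= (- a)%:E.

(* The slope -a/2 of phi beats the Lipschitz constant of f by at least 1 once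
   l * a / 2 >= L + 1. *)
Lemma penalty_descent (l : R) (z : sum_prod X P) :
  (0 < l)%R -> (L + 1 <= l * (a / 2))%R -> C z -> penalty f phi l z < +oo ->
  exists y, [/\ ambient_set A y, y != z &
    penalty f phi l y + (1 * mdist y z)%:E <= penalty f phi l z].
Proof.
move=> l0 la Cz lz.
have [r [s [s0 fr phis penE]]] := penalty_lty_fin l0 lz.
have [[Az phiz] fz] := Cz.
(* Halving [a] makes the bound strict, as extracting a point requires. *)
have zdesc : steepest_descent (ambient_set A) phi z < (- (a / 2))%:E.
  apply: le_lt_trans (phi_descent Cz _) _; first by rewrite phis ltry.
  by rewrite lte_fin ltrN2 ltr_pdivrMr// ltr_pMr// ltr1n.
move: fz; rewrite penE lte_fin => fz.
(* With this threshold, [phi y < s] will give a penalty at [lambda0] below [fstar], keeping [y] in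
   [C]. *)
have fusc : \forall y \near z, f y.1 < (fstar - lambda0 * s)%:E.
  have zC : (fst @` C) z.1 by exists z.
  have /(f_usc zC) : f z.1 < (fstar - lambda0 * s)%:E.
    by rewrite fr lte_fin; lra.
  exact: sum_prod_fst_continuous.
have [|y [Ay fy yz phiy]] := steepest_descent_lt _ zdesc fusc.
  by rewrite phis.
have d0 : (0 < mdist y z)%R by rewrite mdist_gt0.
have [t [t0 phit ts]] : exists t, [/\ (0 <= t)%R, phi y = t%:E &
    (t < s - a / 2 * mdist y z)%R].
  move: phiy (phi_ge0 y); rewrite phis -EFinD; case: (phi y) => [t| |]//.
  by rewrite lte_fin lee_fin => ? ?; exists t; split=> //; lra.
have ad0 : (0 < a / 2 * mdist y z)%R by rewrite mulr_gt0// divr_gt0.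
have [q fq] : exists q, f y.1 = q%:E.
  by move: fy (f_gtNy y.1); case: (f y.1) => [q| |]//; exists q.
have Cy : C y.
  split; first split=> //.
    by apply: le_lt_trans phiz; rewrite phit phis lee_fin; lra.
  move: fy; rewrite /penalty fq phit -EFinM -EFinD !lte_fin => fy.
  have : (lambda0 * t <= lambda0 * s)%R by rewrite ler_wpM2l//; lra.
  by lra.
have qr : (q <= r + L * mdist y z)%R.
  have : `|f y.1 - f z.1| <= (L * mdist y.1 z.1)%:E.
    by apply: f_lip; [exists y|exists z].
  rewrite fq fr -EFinB abse_EFin lee_fin => /(le_trans (ler_norm _)).
  have : (L * mdist y.1 z.1 <= L * mdist y z)%R.
    by rewrite ler_wpM2l// lerDl mdist_ge0.
  by lra.
exists y; split=> //; rewrite penE /penalty fq phit -EFinM -!EFinD lee_fin.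
have : (l * t <= l * (s - a / 2 * mdist y z))%R by rewrite ler_wpM2l// ltW.
have : ((L + 1) * mdist y z <= l * (a / 2) * mdist y z)%R.
  by rewrite ler_wpM2r// ltW.
by lra.
Qed.

End descent.
End exactness.

(** * The equivalence, by choice of a large multiplier *)

Theorem theorem3p6 (R : realType) (X P : completeMetricType R)
  (M A : set X) (f : X -> \bar R) (fstar : R) (p0 : P)
  (phi : sum_prod X P -> \bar R)
  (M_nonempty : M !=set0) (A_nonempty : A !=set0)
  (f_gtNy : forall x, -oo < f x)
  (domf_nonempty : exists x, `|f x| < +oo)
  (fstar_min : exists2 x, optimal_solution M A f x & f x = fstar%:E)
  (phi_ge0 : forall z, 0 <= phi z)
  (phi_eq0 : forall x p, phi (x, p) = 0 <-> p = p0 /\ M x)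
  (A_closed : closed A)
  (f_lsc : forall x, A x -> lsc_at f x)
  (phi_lsc : forall z : sum_prod X P, ambient_set A z -> lsc_at phi z)
  (hC : exists delta lambda0 : R,
    let C := C_set A f phi delta lambda0 fstar in
    [/\ (0 < delta)%R, (0 <= lambda0)%R,
        elipschitz_on (fst @` C) f,
        forall x, (fst @` C) x -> usc_at f x &
        exists2 a : R, (0 < a)%R &
          forall z, C z -> phi z < +oo ->
            steepest_descent (ambient_set A) phi z <= (- a)%:E]) :
  globally_exact M A f p0 phi <->
  exists2 lambda : R, (0 <= lambda)%R &
    bounded_below_on (ambient_set A) (penalty f phi lambda).
Proof.
split; first exact: (exact_bounded_below fstar_min phi_eq0).
move=> [l1 l1_ge0 [c lower]].
have [delta [lambda0 /= [delta_gt0 lambda0_ge0 [L L_ge0 f_lip] f_usc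
  [a a_gt0 phi_descent]]]] := hC.
(* The summands serve in turn to compare with [F_lambda0], to inherit the lower bound [c], to make
   descent beat [L + 1], and to lift [c] to [fstar] where [phi >= delta]. *)
pose l := (lambda0 + l1 + 2 * (L + 1) / a + `|fstar - c| / delta)%R.
have Lla : (L + 1 = 2 * (L + 1) / a * (a / 2))%R by field; lra.
have La0 : (0 < 2 * (L + 1) / a)%R by rewrite divr_gt0//; lra.
have cdelta0 : (0 <= `|fstar - c| / delta)%R by rewrite divr_ge0// ltW.
have l_gt0 : (0 < l)%R by rewrite /l; lra.
have lLa : (L + 1 <= l * (a / 2))%R.
  by rewrite {1}Lla ler_wpM2r//; [lra|rewrite /l; lra].
have l_bnd : bounded_below_on (ambient_set A) (penalty f phi l).
  exists c => z Az; apply: le_trans (lower _ Az) _.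
  by apply: penalty_le => //; rewrite /l; lra.
have in_C z : ambient_set A z -> penalty f phi l z < fstar%:E ->
    C_set A f phi delta lambda0 fstar z.
  move=> Az lz; have [r [s [s0 fr phis penE]]] :=
    penalty_lty_fin f_gtNy phi_ge0 l_gt0 (lt_trans lz (ltry _)).
  split; last first.
    by apply: le_lt_trans lz; apply: penalty_le => //; rewrite /l; lra.
  split=> //; rewrite ltNge; apply/negP; rewrite phis lee_fin => delta_s.
  move: lz (lower _ Az); rewrite !penE lte_fin lee_fin => lz1 lz2.
  have gap : (`|fstar - c| <= `|fstar - c| / delta * s)%R.
    by rewrite -mulrA ler_peMr// mulrC ler_pdivlMr// mul1r.
  have := ler_norm (fstar - c)%R.
  have : ((l1 + `|fstar - c| / delta) * s <= l * s)%R.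
    by rewrite ler_wpM2r// /l; lra.
  by lra.
apply: (exact_of_penalty_ge f_gtNy fstar_min phi_ge0 phi_eq0 (ltW l_gt0)).
move=> z0 Az0.
rewrite leNgt; apply/negP => lz0.
(* Ekeland's constant is 1, matching the surplus in [L + 1]. *)
have [||z [Az zmin ekl]] := ekeland (sum_prod_complete (X := X) (P := P))
  _ _ l_bnd ltr01 Az0 (lt_trans lz0 (ltry _)).
- suff -> : ambient_set A = fst @^-1` A :> set (sum_prod X P).
    by apply: preimage_closed => // z _; exact: sum_prod_fst_continuous.
  by apply/seteqP; split=> z; [case|split].
- move=> z Az; apply: lsc_atD => //.
  + by rewrite (lt_le_trans (ltNyr 0))// mule_ge0// lee_fin ltW.
  + apply: (@lsc_at_comp _ (sum_prod X P) X fst f).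
      exact: sum_prod_fst_continuous.
    by apply: f_lsc; case: Az.
  + by apply: lsc_atZ => //; exact: phi_lsc.
have lz := le_lt_trans zmin lz0.
have [y [Ay yz ley]] := penalty_descent f_gtNy phi_ge0 f_lip f_usc L_ge0 a_gt0
  lambda0_ge0 phi_descent l_gt0 lLa (in_C _ Az lz) (lt_trans lz (ltry _)).
by have := ekl y Ay yz; rewrite ltNge ley.
Qed.
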